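(* Let $a>0$, $b\ge0$, $u_0\in\mathbb{R}$, $c>0$, and let $u$ be a solution on the interval $[0,c]$ of $$\frac{u''}{(1+u'^2)^{3/2}}+\frac1r\,\frac{u'}{\sqrt{1+u'^2}}=ar^2+b,\qquad u(0)=u_0,\quad u'(0)=0.$$ Define $$y(r)=R+u_0-\sqrt{R^2-r^2},\qquad R=c\,\frac{\sqrt{1+u'(c)^2}}{u'(c)},\qquad w(r)=y(r)-y(c)+u(c).$$ Then $w(r)<u(r)$ for all $0\le r<c$.
   Context: A solution $u=u(r)$ is a $C^2$ function on $[0,c]$ satisfying the differential equation for $r\in(0,c]$ together with the initial conditions at $r=0$. It is the profile curve of a surface of revolution about the $x_3$-axis, $(r\cos\theta,r\sin\theta,u(r))$, whose mean curvature $H$ with respect to the upward normal satisfies $2H=ar^2+b$. The graph of $w$ is a vertical translate of a piece of a lower half-circle of radius $R$, with $w(c)=u(c)$ and $w'(c)=u'(c)$. *)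

(* Defs.v *)
From Stdlib Require Export Reals.
Open Scope R_scope.

(* C^2 on the closed interval [p, q], with first and second derivatives df and
   ddf.  [D_in] and [continue_in] are relative to the interval, hence one-sided
   at p and q; for p < q they determine df and ddf on [p, q], and the values of
   f, df and ddf off [p, q] play no role. *)
Definition C2_on (p q : R) (f df ddf : R -> R) : Prop :=
  let I := fun x => p <= x <= q in
  forall x, I x -> D_in f df I x /\ D_in df ddf I x /\ continue_in ddf I x.

Definition is_solution (a b u0 c : R) (u du ddu : R -> R) : Prop :=
  C2_on 0 c u du ddu /\
  (forall r, 0 < r <= c ->
     ddu r / Rpower (1 + du r ^ 2) (3 / 2)
       + 1 / r * (du r / sqrt (1 + du r ^ 2)) = a * r ^ 2 + b) /\
  u 0 = u0 /\ du 0 = 0.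

(* Main.v *)
Require Import Defs.
From Stdlib Require Import Reals.
From Stdlib Require Import Lra Psatz.
Open Scope R_scope.

(** Write [psi] for the angle between the profile curve and the horizontal, so
    that [sin psi = u' / sqrt (1 + u'^2)].  Multiplied by [r], the differential
    equation says that [(r sin psi)' = r (a r^2 + b)].  Since [r sin psi]
    vanishes at [0], integrating gives the first integral
    [sin psi = r (a r^2 / 4 + b / 2)] on [0 < r <= c] ([first_integral]).

    In particular [sin psi / r] increases with [r].  For the circle of radius
    [R] the same quotient is the constant [1 / R], and [R] is chosen so that
    the two agree at [r = c].  Hence [sin psi] is smaller along [u] than along
    the circle for [0 < r < c]; as [slope |-> sine] is strictly increasing
    ([slope_sin_lt_inv]), [u' < w'] there.  So [u - w] strictly decreases, and
    it vanishes at [c]; it is therefore positive before [c].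

    The derivatives of [u] at [0] and [c] are one-sided.  The mean value
    theorem is applied to functions of [u] and [u'] extended by constants beyond
    the interval ([clamp]): these extensions are continuous on the whole line,
    and inside the interval nothing changes. *)

(** * The mean value theorem and one-sided endpoints *)

(** The intermediate point must be interior: the slopes of [u] and [w] agree at
    [c], so a point of the closed interval would not give strictness. *)
Lemma mean_value (f df : R -> R) (p q : R) :
  p < q ->
  (forall x, p < x < q -> derivable_pt_lim f x (df x)) ->
  (forall x, p <= x <= q -> continuity_pt f x) ->
  exists x, p < x < q /\ f q - f p = df x * (q - p).
Proof.
intros pq Df Cf.
pose (prf := fun x (hx : p < x < q) =>
  exist (fun l => derivable_pt_abs f x l) (df x) (Df x hx)).
pose (prid := fun x (_ : p < x < q) => derivable_pt_id x).
destruct (MVT f id p q prf prid pq Cf) as [x [hx E]].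
- intros x _. apply derivable_continuous_pt, derivable_pt_id.
- exists x. split; [exact hx |].
  unfold prid in E. rewrite derive_pt_id in E. simpl in E. unfold id in E. lra.
Qed.

Definition clamp (p q x : R) : R := Rmax p (Rmin q x).

Lemma clamp_in (p q x : R) : p <= q -> p <= clamp p q x <= q.
Proof.
intros pq. unfold clamp, Rmax, Rmin. repeat destruct Rle_dec; lra.
Qed.

Lemma clamp_id (p q x : R) : p <= x <= q -> clamp p q x = x.
Proof.
intros hx. unfold clamp, Rmax, Rmin. repeat destruct Rle_dec; lra.
Qed.

Lemma clamp_lipschitz (p q x y : R) :
  Rabs (clamp p q x - clamp p q y) <= Rabs (x - y).
Proof.
unfold clamp, Rmax, Rmin, Rabs.
repeat destruct Rle_dec; repeat destruct Rcase_abs; lra.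
Qed.

Lemma continuity_clamp (f : R -> R) (p q x : R) :
  p <= q ->
  (forall z, p <= z <= q -> continue_in f (fun z => p <= z <= q) z) ->
  continuity_pt (fun z => f (clamp p q z)) x.
Proof.
intros pq Cf eps heps.
destruct (Cf _ (clamp_in p q x pq) eps heps) as [d [hd Hd]].
exists d. split; [exact hd |].
intros z [_ hz]. simpl in *. unfold Rdist in *.
destruct (Req_dec (clamp p q x) (clamp p q z)) as [E | E].
- rewrite <- E, Rminus_diag, Rabs_R0. exact heps.
- apply Hd. split.
  + split; [apply clamp_in; exact pq | exact E].
  + apply Rle_lt_trans with (2 := hz). apply clamp_lipschitz.
Qed.

Lemma derivable_clamp (f df : R -> R) (p q x : R) :
  p < x < q ->
  D_in f df (fun z => p <= z <= q) x ->
  derivable_pt_lim (fun z => f (clamp p q z)) x (df x).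
Proof.
intros hx Df eps heps.
destruct (Df eps heps) as [d [hd Hd]].
assert (hm : 0 < Rmin d (Rmin (x - p) (q - x))).
{ repeat apply Rmin_pos; lra. }
exists (mkposreal _ hm). intros h hn hh. simpl in hh.
pose proof (Rmin_l d (Rmin (x - p) (q - x))).
pose proof (Rmin_r d (Rmin (x - p) (q - x))).
pose proof (Rmin_l (x - p) (q - x)).
pose proof (Rmin_r (x - p) (q - x)).
assert (hh' : Rabs h < Rmin (x - p) (q - x)) by lra.
assert (hb : p <= x + h <= q).
{ revert hh'. unfold Rabs. destruct Rcase_abs; lra. }
rewrite (clamp_id p q x), (clamp_id p q (x + h)) by lra.
specialize (Hd (x + h)). simpl in Hd. unfold Rdist in Hd.
replace (x + h - x) with h in Hd by ring.
apply Hd. repeat split; lra.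
Qed.

(** * The sine of the inclination angle as a function of the slope *)

Definition slope_sin (m : R) : R := m / sqrt (1 + m ^ 2).

Lemma sqrt_slope_pos (m : R) : 0 < sqrt (1 + m ^ 2).
Proof. apply sqrt_lt_R0. nra. Qed.

Lemma Rpower_3_2 (x : R) : 0 < x -> Rpower x (3 / 2) = x * sqrt x.
Proof.
intros hx. replace (3 / 2) with (1 + / 2) by field.
rewrite Rpower_plus, Rpower_1, Rpower_sqrt; trivial.
Qed.

Lemma derivable_slope_sin (m : R) :
  derivable_pt_lim slope_sin m (/ Rpower (1 + m ^ 2) (3 / 2)).
Proof.
assert (hp : 0 < 1 + m ^ 2) by nra.
pose proof (sqrt_slope_pos m) as hs.
assert (Ds : derivable_pt_lim (fun z => sqrt (1 + z ^ 2)) m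
               (/ (2 * sqrt (1 + m ^ 2)) * (2 * m))).
{ apply (derivable_pt_lim_comp (fun z => 1 + z ^ 2) sqrt).
  - replace (2 * m) with (0 + INR 2 * m ^ 1) by (simpl; ring).
    apply (derivable_pt_lim_plus (fun _ => 1) (fun z => z ^ 2)).
    + apply derivable_pt_lim_const.
    + apply derivable_pt_lim_pow.
  - apply derivable_pt_lim_sqrt. exact hp. }
rewrite Rpower_3_2 by exact hp.
pose proof (derivable_pt_lim_div id _ m _ _ (derivable_pt_lim_id m) Ds
  (Rgt_not_eq _ _ hs)) as D.
replace (/ ((1 + m ^ 2) * sqrt (1 + m ^ 2))) with
  ((1 * sqrt (1 + m ^ 2) - / (2 * sqrt (1 + m ^ 2)) * (2 * m) * id m)
     / Rsqr (sqrt (1 + m ^ 2))); [exact D |].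
rewrite Rsqr_sqrt by lra. unfold id.
pose proof (sqrt_sqrt (1 + m ^ 2) (Rlt_le _ _ hp)) as E.
set (s := sqrt (1 + m ^ 2)) in *.
rewrite <- E.
field_simplify; [| lra | lra].
replace (m ^ 2) with (s * s - 1) by (rewrite E; ring).
field. lra.
Qed.

Lemma slope_sin_lt_inv (m n : R) : slope_sin m < slope_sin n -> m < n.
Proof.
intros h. apply Rnot_le_lt. intros [nm | E].
- destruct (mean_value slope_sin (fun z => / Rpower (1 + z ^ 2) (3 / 2)) n m)
    as [x [_ Ex]].
  + exact nm.
  + intros x _. apply derivable_slope_sin.
  + intros x _. apply derivable_continuous_pt.
    eexists. apply derivable_slope_sin.
  + assert (0 < / Rpower (1 + x ^ 2) (3 / 2)).
    { apply Rinv_0_lt_compat. apply exp_pos. }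
    nra.
- subst n. lra.
Qed.

(** The slope at abscissa [r] of a lower half-circle of radius [R], namely
    [r / sqrt (R^2 - r^2)], belongs to an angle of sine [r / R]. *)
Lemma slope_sin_circle (rad r : R) :
  0 < rad -> 0 < rad ^ 2 - r ^ 2 ->
  slope_sin (r / sqrt (rad ^ 2 - r ^ 2)) = r / rad.
Proof.
intros hR hD. unfold slope_sin.
pose proof (sqrt_lt_R0 _ hD) as hs.
pose proof (sqrt_sqrt _ (Rlt_le _ _ hD)) as E.
set (s := sqrt (rad ^ 2 - r ^ 2)) in *.
replace (1 + (r / s) ^ 2) with ((rad / s) ^ 2).
- rewrite sqrt_pow2.
  + field. lra.
  + apply Rlt_le, Rdiv_lt_0_compat; lra.
- unfold Rdiv. rewrite !Rpow_mult_distr.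
  replace (rad ^ 2) with (s * s + r ^ 2) by (rewrite E; ring).
  field. lra.
Qed.

Lemma derivable_lower_circle (rad k r : R) :
  0 < rad ^ 2 - r ^ 2 ->
  derivable_pt_lim (fun x => k - sqrt (rad ^ 2 - x ^ 2)) r
    (r / sqrt (rad ^ 2 - r ^ 2)).
Proof.
intros hD. pose proof (sqrt_lt_R0 _ hD) as hs.
replace (r / sqrt (rad ^ 2 - r ^ 2)) with
  (0 - / (2 * sqrt (rad ^ 2 - r ^ 2)) * (0 - INR 2 * r ^ 1))
  by (rewrite pow_1; change (INR 2) with (1 + 1); field; lra).
apply (derivable_pt_lim_minus (fun _ => k) (fun x => sqrt (rad ^ 2 - x ^ 2))).
- apply derivable_pt_lim_const.
- apply (derivable_pt_lim_comp (fun x => rad ^ 2 - x ^ 2) sqrt).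
  + apply (derivable_pt_lim_minus (fun _ => rad ^ 2) (fun x => x ^ 2)).
    * apply derivable_pt_lim_const.
    * apply derivable_pt_lim_pow.
  + apply derivable_pt_lim_sqrt. exact hD.
Qed.

(** * The profile curve and the comparison circle *)

(** The function [r sin psi - (a r^4 / 4 + b r^2 / 2)] vanishes at [0], and its
    derivative is [r] times the difference of the two sides of the differential
    equation. *)
Lemma first_integral (a b u0 c : R) (u du ddu : R -> R) (r : R) :
  is_solution a b u0 c u du ddu -> 0 < r <= c ->
  slope_sin (du r) = r * (a * r ^ 2 / 4 + b / 2).
Proof.
intros [C2 [ode _]] hr.
pose (v := fun x => du (clamp 0 c x)).
pose (poly := fun x => a / 4 * x ^ 4 + b / 2 * x ^ 2).
assert (Dpoly : forall x, derivable_pt_lim poly x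
                  (a / 4 * (INR 4 * x ^ 3) + b / 2 * (INR 2 * x ^ 1))).
{ intros x.
  apply (derivable_pt_lim_plus (fun z => a / 4 * z ^ 4)
                               (fun z => b / 2 * z ^ 2)).
  - apply (derivable_pt_lim_scal (fun z => z ^ 4)), derivable_pt_lim_pow.
  - apply (derivable_pt_lim_scal (fun z => z ^ 2)), derivable_pt_lim_pow. }
destruct (mean_value (fun x => x * slope_sin (v x) - poly x) (fun _ => 0) 0 r)
  as [x [_ E]].
- lra.
- intros x hx.
  assert (hv : v x = du x) by (unfold v; rewrite clamp_id by lra; reflexivity).
  assert (Dv : derivable_pt_lim v x (ddu x)).
  { apply derivable_clamp; [lra |]. apply C2. lra. }
  pose proof (derivable_pt_lim_comp v slope_sin x _ _ Dv
    (derivable_slope_sin (v x))) as Ds.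
  pose proof (derivable_pt_lim_mult id _ x _ _ (derivable_pt_lim_id x) Ds)
    as Dm.
  pose proof (derivable_pt_lim_minus _ _ x _ _ Dm (Dpoly x)) as D.
  eapply eq_ind with (P := derivable_pt_lim _ x); [exact D |].
  unfold comp, id. rewrite hv.
  assert (hode := ode x ltac:(lra)).
  fold (slope_sin (du x)) in hode.
  set (k := Rpower (1 + du x ^ 2) (3 / 2)) in *.
  assert (hk : 0 < k) by apply exp_pos.
  assert (E : x * (ddu x / k + 1 / x * slope_sin (du x))
              = x * (a * x ^ 2 + b)) by (rewrite hode; reflexivity).
  replace (x * (ddu x / k + 1 / x * slope_sin (du x)))
    with (1 * slope_sin (du x) + x * (/ k * ddu x)) in E by (field; lra).
  rewrite E. simpl. field.
- intros x _. apply continuity_pt_minus.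
  + apply (continuity_pt_mult id (fun z => slope_sin (v z))).
    * apply derivable_continuous_pt, derivable_pt_id.
    * apply (continuity_pt_comp v slope_sin).
      -- apply continuity_clamp; [lra |]. intros z hz.
         apply (cont_deriv du ddu), C2, hz.
      -- apply derivable_continuous_pt. eexists. apply derivable_slope_sin.
  + apply derivable_continuous_pt. eexists. apply Dpoly.
- assert (hv : v r = du r) by (unfold v; rewrite clamp_id by lra; reflexivity).
  rewrite hv in E. unfold poly in E.
  apply Rmult_eq_reg_l with r; [| lra]. nra.
Qed.

Theorem theorem6 (a b u0 c : R) (u du ddu : R -> R)
  (ha : 0 < a) (hb : 0 <= b) (hc : 0 < c)
  (hu : is_solution a b u0 c u du ddu) :
  let rad := c * sqrt (1 + du c ^ 2) / du c in
  let y := fun r : R => rad + u0 - sqrt (rad ^ 2 - r ^ 2) in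
  let w := fun r : R => y r - y c + u c in
  forall r : R, 0 <= r < c -> w r < u r.
Proof.
intros rad y w r hr.
pose proof (first_integral _ _ _ _ _ _ _ c hu ltac:(lra)) as Ec.
pose proof (sqrt_slope_pos (du c)) as hs.
assert (hk : 0 < a * c ^ 2 / 4 + b / 2).
{ assert (0 < a * c ^ 2) by (apply Rmult_lt_0_compat, pow_lt; lra). lra. }
assert (hdu : 0 < du c).
{ apply slope_sin_lt_inv. rewrite Ec. unfold slope_sin, Rdiv at 1.
  rewrite Rmult_0_l. nra. }
assert (hR : 0 < rad).
{ unfold rad. apply Rdiv_lt_0_compat; [apply Rmult_lt_0_compat |]; lra. }
(* The curvature [1 / R] of the circle is the value of [sin psi / r] at [c]. *)
assert (curv : / rad = a * c ^ 2 / 4 + b / 2).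
{ apply Rmult_eq_reg_l with c; [| lra]. rewrite <- Ec.
  unfold rad, slope_sin. field. lra. }
(* [R > c] because the slope of [u] at [c] is finite; thus the half-circle is
   smooth for [0 <= r <= c]. *)
assert (hRc : rad ^ 2 - c ^ 2 = (c / du c) ^ 2).
{ unfold rad. pose proof (sqrt_sqrt (1 + du c ^ 2) ltac:(nra)) as E.
  set (s := sqrt (1 + du c ^ 2)) in *.
  replace ((c * s / du c) ^ 2) with (c ^ 2 * (s * s) / du c ^ 2)
    by (field; lra).
  rewrite E. field. lra. }
assert (hcirc : forall x, 0 <= x <= c -> 0 < rad ^ 2 - x ^ 2).
{ intros x hx. assert (0 < c / du c) by (apply Rdiv_lt_0_compat; lra). nra. }
pose proof (proj1 hu) as C2.
destruct (mean_value (fun x => u (clamp 0 c x) - y x)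
  (fun x => du x - x / sqrt (rad ^ 2 - x ^ 2)) r c) as [x [hx E]].
- lra.
- intros x hx.
  apply (derivable_pt_lim_minus (fun z => u (clamp 0 c z)) y).
  + apply derivable_clamp; [lra |]. apply C2. lra.
  + apply derivable_lower_circle, hcirc. lra.
- intros x hx.
  apply (continuity_pt_minus (fun z => u (clamp 0 c z)) y).
  + apply continuity_clamp; [lra |]. intros z hz.
    apply (cont_deriv u du), C2, hz.
  + apply derivable_continuous_pt. eexists.
    apply derivable_lower_circle, hcirc. lra.
- assert (hlt : du x < x / sqrt (rad ^ 2 - x ^ 2)).
  { apply slope_sin_lt_inv.
    rewrite slope_sin_circle by (try apply hcirc; lra).
    rewrite (first_integral _ _ _ _ _ _ _ x hu) by lra.
    unfold Rdiv at 3. rewrite curv.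
    apply Rmult_lt_compat_l; [lra |].
    assert (a * x ^ 2 < a * c ^ 2) by (apply Rmult_lt_compat_l; nra). lra. }
  rewrite !clamp_id in E by lra. unfold w. nra.
Qed.
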